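(* Let $\mathcal{A}$ and $\mathcal{B}$ be $\sigma$-structures whose cumulative power hierarchies are generated by the families of index sets $\{I_\alpha\}_{\alpha\in\mathbf{On}}$ and $\{J_\alpha\}_{\alpha\in\mathbf{On}}$ respectively. If $\mathcal{A}$ embeds into $\mathcal{B}$ and $|I_\alpha|\le|J_\alpha|$ for every $\alpha\in\mathbf{On}$, then for all ordinals $\beta\le\gamma$, $\mathcal{F}_\beta(\mathcal{A})$ embeds into $\mathcal{F}_\gamma(\mathcal{B})$.
   Context: Index sets are assumed to have cardinality greater than $1$. For a $\sigma$-structure $\mathcal{A}$ and index sets $\{I_\alpha\}$: $\mathcal{F}_0(A)=A$, $\mathcal{F}_{\beta+1}(A)=\mathcal{F}_\beta(A)^{I_\beta}\cup\mathcal{F}_\beta(A)$ (where $X^I$ is the set of functions $I\to X$), $\mathcal{F}_\lambda(A)=\bigcup_{\alpha<\lambda}\mathcal{F}_\alpha(A)$ for limit $\lambda$. The level $\rho(a)$ is the least $\beta$ with $a\in\mathcal{F}_\beta(A)$. For an ordinal $\alpha$ and index $j$, $\vartheta^\alpha_j(a)=a(j)$ if $\rho(a)\ge\alpha$ and $j\in\mathrm{dom}(a)$, else $\vartheta^\alpha_j(a)=a$. The structure $\mathcal{F}_\beta(\mathcal{A})$ has domain $\mathcal{F}_\beta(A)$, identity as equality, and for each $n$-ary function symbol $F$, relation symbol $R$ and constant symbol $c$ of $\sigma$ an operation $F_\beta$, relation $R_\beta$ and unary predicate $\mathbf{c}_\beta$: with $\delta=\max_i\rho(a_i)$, if $\delta=0$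 they agree with $\mathcal{A}$; if $\delta>0$, $F_\beta(a_1,\dots,a_n)$ is the unique $b$ with $\rho(b)=\delta$ and $b(j)=F_{\delta-1}(\vartheta^\delta_j(a_1),\dots,\vartheta^\delta_j(a_n))$ for all $j\in I_{\delta-1}$, and $R_\beta(a_1,\dots,a_n)$ iff $R_{\delta-1}(\vartheta^\delta_j(a_1),\dots,\vartheta^\delta_j(a_n))$ for all $j\in I_{\delta-1}$; $\mathbf{c}_0=\{c^{\mathcal{A}}\}$, $\mathbf{c}_{\beta+1}=(\mathbf{c}_\beta)^{I_\beta}\cup\mathbf{c}_\beta$, $\mathbf{c}_\lambda=\bigcup_{\alpha<\lambda}\mathbf{c}_\alpha$. An embedding is an injective map preserving the operations, and preserving and reflecting the relations and the predicates $\mathbf{c}$ (constants in the case of $\sigma$-structures).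
   Formalization: Added hypothesis: whenever J_α = J_β, also I_α = I_β. Without it the claim fails: for one-point A = B, no symbols, disjoint 2-element I_0, I_1 and J_0 = J_1 of size 2, |F_2(A)| = 6 > 5 = |F_2(B)|. Elements of A and B are treated as urelements. *)

(* Defs.v *)
From mathcomp Require Import all_boot all_order.
From mathcomp Require Import boolp classical_sets functions cardinality wochoice.
Set Implicit Arguments.
Unset Strict Implicit.
Unset Printing Implicit Defensive.
Import Order.TTheory.
Local Open Scope order_scope.
Local Open Scope classical_set_scope.

(* Constants are kept apart from function symbols, whose arity is positive:
   the maximal level of the arguments must exist.                             *)
Record signature := Signature {
  fun_sym : Type;
  rel_sym : Type;
  cst_sym : Type;
  fun_arity : fun_sym -> nat;
  rel_arity : rel_sym -> nat;
  fun_arity_gt0 : forall f, (0 < fun_arity f)%N;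
  rel_arity_gt0 : forall r, (0 < rel_arity r)%N }.

Record structure (s : signature) := Structure {
  carrier :> Type;
  fint : forall f : fun_sym s, ('I_(fun_arity f) -> carrier) -> carrier;
  rint : forall r : rel_sym s, ('I_(rel_arity r) -> carrier) -> Prop;
  cint : cst_sym s -> carrier }.

(* In a power structure a constant symbol is interpreted by a predicate. *)
Record power_structure (s : signature) := PowerStructure {
  power_carrier :> Type;
  power_fint : forall f : fun_sym s,
    ('I_(fun_arity f) -> power_carrier) -> power_carrier;
  power_rint : forall r : rel_sym s,
    ('I_(rel_arity r) -> power_carrier) -> Prop;
  power_cint : cst_sym s -> power_carrier -> Prop }.

Definition is_embedding (s : signature) (A B : structure s) (h : A -> B) :=
  [/\ injective h,
      forall f a, h (fint (f := f) a) = fint (h \o a),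
      forall r a, rint (r := r) a <-> rint (h \o a) &
      forall c, h (cint A c) = cint B c].

Definition embeds (s : signature) (A B : structure s) :=
  exists h : A -> B, is_embedding h.

Definition is_power_embedding (s : signature) (A B : power_structure s)
    (h : A -> B) :=
  [/\ injective h,
      forall f a, h (power_fint (f := f) a) = power_fint (h \o a),
      forall r a, power_rint (r := r) a <-> power_rint (h \o a) &
      forall c x, power_cint c x <-> power_cint c (h x)].

Definition power_embeds (s : signature) (A B : power_structure s) :=
  exists h : A -> B, is_power_embedding h.

(* Ordinals are the elements of a well-ordered type On, which is arbitrary: every
   ordinal is the position of an element in some such type, and the stages up
   to c only involve the index sets below c.                                  *)
Section Ordinals.
Context {d : Order.disp_t} {On : orderType d}.
Implicit Types a b c : On.

Definition is_zero b := forall a, b <= a.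

Definition is_succ a b := a < b /\ forall c, a < c -> b <= c.

Definition is_limit b := ~ is_zero b /\ ~ exists a, is_succ a b.

End Ordinals.

(* Set-theoretic functions whose domain is a subset of U, iterated over the
   elements of A as urelements. Functions with the same domain and the same
   values are equal, whatever the stage at which they appear.                 *)
Inductive obj (U A : Type) : Type :=
| Atom of A
| Fn (D : set U) of ({u : U | D u} -> obj U A).
Arguments Atom {U A}.
Arguments Fn {U A}.

Definition obj_dom U A (x : obj U A) : set U :=
  if x is Fn D _ then D else set0.

(* x(j), with the irrelevant value x when j is not in the domain of x. *)
Definition obj_app U A (x : obj U A) (j : U) : obj U A :=
  match x with
  | Atom _ => x
  | Fn D f => if pselect (D j) is left Dj then f (exist _ j Dj) else x
  end.

Section Hierarchy.
Context {d : Order.disp_t} {On : orderType d}.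
Context (On_wo : well_order (<=%O : rel On)).
Context {U : Type} (I : On -> set U) {s : signature} (A : structure s).
Local Notation O := (obj U A).
Implicit Types (p q b : On) (x y : O).

Inductive stage : On -> O -> Prop :=
| stage_zero b a : is_zero b -> stage b (Atom a)
| stage_fun p b f : is_succ p b -> (forall j, stage p (f j)) ->
    stage b (Fn (I p) f)
| stage_succ p b x : is_succ p b -> stage p x -> stage b x
| stage_limit p b x : is_limit b -> p < b -> stage p x -> stage b x.

Definition has_level x p := stage p x /\ forall q, stage q x -> p <= q.

Definition theta p (j : U) x : O :=
  if pselect ((exists2 q, has_level x q & p <= q) /\ obj_dom x j) is left _
  then obj_app x j else x.

Definition max_level n (a : 'I_n -> O) p :=
  (exists i, has_level (a i) p) /\
  forall i, exists2 q, has_level (a i) q & q <= p.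

(* op_stage b a y : the operation of the b-th stage sends a to y. *)
Inductive op_stage (f : fun_sym s) :
  On -> ('I_(fun_arity f) -> O) -> O -> Prop :=
| op_stage0 b (a : 'I_(fun_arity f) -> A) :
    @op_stage f b (fun i => Atom (a i)) (Atom (fint a))
| op_stageS b p q (a : 'I_(fun_arity f) -> O) y :
    (forall i, stage b (a i)) -> max_level a q -> is_succ p q ->
    has_level y q ->
    (forall j, I p j -> @op_stage f p (fun i => theta q j (a i)) (obj_app y j)) ->
    @op_stage f b a y.

Inductive rel_stage (r : rel_sym s) : On -> ('I_(rel_arity r) -> O) -> Prop :=
| rel_stage0 b (a : 'I_(rel_arity r) -> A) :
    rint a -> @rel_stage r b (fun i => Atom (a i))
| rel_stageS b p q (a : 'I_(rel_arity r) -> O) :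
    (forall i, stage b (a i)) -> max_level a q -> is_succ p q ->
    (forall j, I p j -> @rel_stage r p (fun i => theta q j (a i))) ->
    @rel_stage r b a.

Inductive cst_stage (c : cst_sym s) : On -> O -> Prop :=
| cst_stage_zero b : is_zero b -> @cst_stage c b (Atom (cint A c))
| cst_stage_fun p b f : is_succ p b -> (forall j, @cst_stage c p (f j)) ->
    @cst_stage c b (Fn (I p) f)
| cst_stage_succ p b x : is_succ p b -> @cst_stage c p x -> @cst_stage c b x
| cst_stage_limit p b x : is_limit b -> p < b -> @cst_stage c p x ->
    @cst_stage c b x.

Lemma wo_min (P : set On) : (exists b, P b) ->
  exists b, P b /\ forall q, P q -> b <= q.
Proof.
move=> [b0 Pb0].
have /On_wo[b [[bP bmin] _]] : nonempty [pred b | `[< P b >]].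
  by exists b0; apply/asboolP.
exists b; split; first exact/asboolP.
by move=> q Pq; apply: bmin; apply/asboolP.
Qed.

Lemma wo_ind (P : On -> Prop) :
  (forall b, (forall q, q < b -> P q) -> P b) -> forall b, P b.
Proof.
move=> IH b; apply: contrapT => nPb.
have [|p [nPp pmin]] := @wo_min (fun b => ~ P b); first by exists b.
apply: nPp; apply: IH => q qp; apply: contrapT => /pmin.
by rewrite leNgt qp.
Qed.

Lemma is_succ_inj p p' b : is_succ p b -> is_succ p' b -> p = p'.
Proof.
move=> [pb minp] [p'b minp']; apply/eqP; rewrite eq_le !leNgt.
by apply/andP; split; apply/negP => /[dup] lt;
  [move/minp'|move/minp]; rewrite leNgt ?pb ?p'b.
Qed.

Lemma succ_le p b q : is_succ p b -> q < b -> q <= p.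
Proof.
by move=> [_ minp] qb; rewrite leNgt; apply/negP => /minp; rewrite leNgt qb.
Qed.

Lemma succ_nonzero p b : is_succ p b -> ~ is_zero b.
Proof. by move=> [pb _] /(_ p); rewrite leNgt pb. Qed.

Lemma stage_mono p b x : p <= b -> stage p x -> stage b x.
Proof.
elim/wo_ind: b => b IH; rewrite le_eqVlt => /orP[/eqP-> //|pb] px.
have [z|nz] := pselect (is_zero b); first by move: (z p); rewrite leNgt pb.
have [[q qb]|ns] := pselect (exists q, is_succ q b).
  by apply: (stage_succ qb); apply: IH px; [case: qb|exact: succ_le pb].
exact: stage_limit pb px.
Qed.

Lemma has_level_ex b x : stage b x -> exists2 p, has_level x p & p <= b.
Proof.
move=> bx; have [|p [px pmin]] := @wo_min (fun b => stage b x).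
  by exists b.
by exists p; [split|exact: pmin].
Qed.

Lemma has_level_inj x p q : has_level x p -> has_level x q -> p = q.
Proof. by move=> [px pm] [qx qm]; apply/eqP; rewrite eq_le pm ?qm. Qed.

Lemma has_levelP x q : has_level x q ->
  (is_zero q /\ exists a, x = Atom a) \/
  exists p, is_succ p q /\
    exists2 f, x = Fn (I p) f & forall j, stage p (f j).
Proof.
move=> [qx]; case: q x / qx.
- by move=> b a z _; left; split=> //; exists a.
- by move=> p b f pb fp _; right; exists p; split=> //; exists f.
- by move=> p b x [pb _] px /(_ _ px); rewrite leNgt pb.
- by move=> p b x _ pb px /(_ _ px); rewrite leNgt pb.
Qed.

Lemma zero_Atom b x : is_zero b -> stage b x -> exists a, x = Atom a.
Proof.
move=> z bx; have [p px pb] := has_level_ex bx.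
have [[_]//|[q [qp _]]] := has_levelP px.
by case: (succ_nonzero qp) => r; apply: le_trans (z r).
Qed.

Lemma stage_Atom b a : stage b (Atom a).
Proof.
have [|p [_ pmin]] := @wo_min setT; first by exists b.
apply: (@stage_mono p); first exact: pmin.
by apply: stage_zero => q; apply: pmin.
Qed.

Lemma obj_appE (D : set U) (f : {u | D u} -> O) j (Dj : D j) :
  obj_app (Fn D f) j = f (exist _ j Dj).
Proof.
by rewrite /obj_app; case: pselect => // Dj'; congr (f (exist _ _ _));
  exact: Prop_irrelevance.
Qed.


Lemma level_succ x p q : has_level x q -> is_succ p q ->
  exists2 f, x = Fn (I p) f & forall j, stage p (f j).
Proof.
move=> /has_levelP[[z _] /succ_nonzero//|[p' [p'q [f -> fp]]]] pq.
by move: f fp; rewrite (is_succ_inj p'q pq) => f fp; exists f.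
Qed.

Lemma max_level_ex n b (a : 'I_n -> O) : (0 < n)%N ->
  (forall i, stage b (a i)) -> exists2 q, max_level a q & q <= b.
Proof.
move=> n0 sa.
have /choice[l lP] i : exists p, has_level (a i) p /\ p <= b.
  by have [p ? ?] := has_level_ex (sa i); exists p.
have i0 : 'I_n by exists 0%N.
have [i _ imax] := @arg_maxP _ _ _ i0 xpredT l erefl.
exists (l i); last by case: (lP i).
split; first by exists i; case: (lP i).
by move=> k; exists (l k); [case: (lP k)|exact: imax].
Qed.

Lemma max_level_inj n (a : 'I_n -> O) p q :
  max_level a p -> max_level a q -> p = q.
Proof.
move=> [[i ip] pm] [[k kq] qm]; apply/eqP; rewrite eq_le.
have [p' /(has_level_inj ip)<- ->] := qm i.
by have [q' /(has_level_inj kq)<- ->] := pm k.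
Qed.

Lemma max_level_stage n b (a : 'I_n -> O) q : max_level a q -> q <= b ->
  forall i, stage b (a i).
Proof.
move=> [_ am] qb i; have [r [ra _] rq] := am i.
exact: stage_mono (le_trans rq qb) ra.
Qed.

Lemma has_level_zero a q : has_level (Atom a) q -> is_zero q.
Proof. by move=> [_ qm] r; apply/qm/stage_Atom. Qed.

Lemma max_level_Atom n (a : 'I_n -> A) q :
  max_level (fun i => Atom (a i)) q -> is_zero q.
Proof. by move=> [[i /has_level_zero]]. Qed.

Lemma thetaE x p q j : has_level x q -> is_succ p q -> I p j ->
  theta q j x = obj_app x j.
Proof.
move=> xq pq pj; rewrite /theta; case: pselect => // -[]; split.
  by exists q.
by have [f -> _] := level_succ xq pq.
Qed.

Lemma theta_lt x r q j : has_level x r -> r < q -> theta q j x = x.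
Proof.
move=> xr rq; rewrite /theta; case: pselect => // -[[q' xq' qq'] _].
by move: qq'; rewrite -(has_level_inj xr xq') leNgt rq.
Qed.

Lemma theta_stage n (a : 'I_n -> O) p q j i : max_level a q -> is_succ p q ->
  I p j -> stage p (theta q j (a i)).
Proof.
move=> [_ am] pq pj; have [r ar] := am i; rewrite le_eqVlt => /orP[/eqP rq|rq].
  move: ar; rewrite rq => ar; rewrite (thetaE ar pq pj).
  by have [f -> fs] := level_succ ar pq; rewrite (obj_appE _ pj).
rewrite (theta_lt j ar rq); apply: stage_mono (succ_le pq rq) _.
by case: ar.
Qed.

Lemma op_stage_level f b (a : 'I_(fun_arity f) -> O) y q :
  op_stage b a y -> max_level a q -> has_level y q.
Proof.
case=> [{}b {}a /max_level_Atom z|{}b p q' {}a {}y _ aq' _ yq' _ aq].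
  by split; [exact: stage_Atom|move=> r _; exact: z].
by rewrite (max_level_inj aq aq').
Qed.

Lemma op_stage_closed f b (a : 'I_(fun_arity f) -> O) y :
  (forall i, stage b (a i)) -> op_stage b a y -> stage b y.
Proof.
move=> sa ay; have [q aq qb] := max_level_ex (fun_arity_gt0 f) sa.
by have [yq _] := op_stage_level ay aq; exact: stage_mono qb yq.
Qed.

Lemma op_stage_inj f b (a : 'I_(fun_arity f) -> O) y y' :
  op_stage b a y -> op_stage b a y' -> y = y'.
Proof.
move=> ay; elim: ay y' => {b a y} [b a y' ay'|].
  move ea: (fun i => Atom (a i)) ay' => a' ay'.
  case: ay' ea => [{}b {}a' ea|{}b p q {}a' y _ aq pq _ _ ea].
    congr (Atom (fint _)); apply/funext => i.
    by move/(congr1 (fun g => g i)): ea => -[].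
  by case: (succ_nonzero pq); move: aq; rewrite -ea; exact: max_level_Atom.
move=> b p q a y _ aq pq yq _ IH y' ay'.
have y'q := op_stage_level ay' aq.
case: ay' aq IH y'q => {b a y'} [b a /max_level_Atom/(succ_nonzero pq)//|].
move=> b p' q' a y' _ aq' p'q' _ ay' aq IH y'q.
move: p'q' ay'; rewrite -(max_level_inj aq aq') => p'q'.
rewrite -(is_succ_inj pq p'q') => ay'.
have [g yE _] := level_succ yq pq; have [g' y'E _] := level_succ y'q pq.
rewrite yE y'E; congr Fn; apply/funext => -[j pj].
by have := IH j pj _ (ay' j pj); rewrite yE y'E !(obj_appE _ pj).
Qed.

Lemma op_stage_ex f b (a : 'I_(fun_arity f) -> O) :
  (forall i, stage b (a i)) -> exists y, op_stage b a y.
Proof.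
elim/wo_ind: b a => b IH a sa.
have [q aq qb] := max_level_ex (fun_arity_gt0 f) sa.
have [[i0 ai0] am] := aq.
have [[z _]|[p [pq _]]] := has_levelP ai0.
  have /choice[a' aE] i : exists c, a i = Atom c.
    by apply: (zero_Atom z); exact: max_level_stage aq _ _.
  by rewrite (funext aE); exists (Atom (fint a')); constructor.
have pb : p < b by case: pq => pq _; exact: lt_le_trans pq qb.
have /choice[g gP] (j : {j | I p j}) :
    exists y, op_stage p (fun i => theta q (sval j) (a i)) y.
  by apply: IH => // i; case: j => j pj; exact: theta_stage aq pq pj.
exists (Fn (I p) g); apply: (op_stageS sa aq pq); last first.
  by move=> j pj; rewrite (obj_appE _ pj); exact: gP (exist _ j pj).
have gs j : stage p (g j).
  apply: op_stage_closed (gP j) => i; case: j => j pj.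
  exact: theta_stage aq pq pj.
have bq : stage q (Fn (I p) g) by exact: stage_fun.
split=> // q' /has_level_ex[r gr rq']; apply: le_trans rq'.
rewrite leNgt; apply/negP => rq.
case/has_levelP: (gr) => [[_ [? //]]|[p' [p'r [g' gE g's]]]].
have pE : I p' = I p by move/(congr1 (@obj_dom _ _)): gE.
have [h ai0E hs] := level_succ ai0 pq.
suff : stage r (a i0) by case: ai0 => _ min_q /min_q; rewrite leNgt rq.
rewrite ai0E.
have : forall j, stage p' (h j).
  move=> [j pj]; have pj' : I p' j by rewrite pE.
  have thE : theta q j (a i0) = h (exist _ j pj).
    by rewrite (thetaE ai0 pq pj) ai0E (obj_appE _ pj).
  have sth i : stage p (theta q j (a i)) by exact: theta_stage aq pq pj.
  have [t tm _] := max_level_ex (fun_arity_gt0 f) sth.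
  have [_ glev] := op_stage_level (gP (exist _ j pj)) tm.
  move/(congr1 (fun x => obj_app x j)): (gE); rewrite (obj_appE _ pj) (obj_appE _ pj') => gE'.
  rewrite -thE; apply: max_level_stage tm _ _; apply: glev.
  by rewrite gE'; exact: g's.
move: h ai0E hs; rewrite -pE => h _ _ hs'.
exact: stage_fun.
Qed.

Section Power.
Context (b : On).

Definition power_op (f : fun_sym s) (a : 'I_(fun_arity f) -> {x | stage b x}) :
    {x | stage b x} :=
  let ex := op_stage_ex (fun i => svalP (a i)) in
  exist _ (sval (cid ex))
    (op_stage_closed (fun i => svalP (a i)) (svalP (cid ex))).

Definition power : power_structure s := {|
  power_carrier := {x | stage b x};
  power_fint := power_op;
  power_rint r a := rel_stage b (fun i => sval (a i) : O);
  power_cint c a := cst_stage c b (sval a) |}.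

End Power.

End Hierarchy.

(* Stages depend on which index sets coincide, not only on their cardinalities:
   if J 0 = J 1, a function from J 1 to B is already in the first stage, while
   if I 0 and I 1 differ, a function from I 1 to A only appears in the second.
   Condition on two families that excludes this mismatch; it holds if the J a
   are pairwise distinct, and if all the I a are equal. Without it embeddings may
   fail to exist: see no_embedding below.                                     *)
Definition index_compatible d (On : orderType d) (U V : Type)
    (I : On -> set U) (J : On -> set V) :=
  forall a b, J a = J b -> I a = I b.

(* For one-point structures A = B without symbols, two-element index sets
   I 0 <> I n for n > 0, and J n all equal to the same two-element set, stage 2
   over A has 6 elements but stage 2 over B only has 5.                       *)
Module IndexCompatible.
Local Open Scope card_scope.

Lemma nat_wo : well_order (<=%O : rel nat).
Proof.
apply: antisymmetric_well_order; first exact: le_anti.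
move=> P [n nP]; have exP : exists n, P n by exists n.
by exists (ex_minn exP); case: ex_minnP => m mP mmin; split=> // k /mmin.
Qed.

Lemma succ_nat n : is_succ n n.+1.
Proof. by split=> [|c nc]; [exact: ltnSn|exact: nc]. Qed.

Definition s0 : signature := {| fun_sym := void; rel_sym := void; cst_sym := void;
  fun_arity := of_void nat; rel_arity := of_void nat;
  fun_arity_gt0 := fun f : void => match f with end; rel_arity_gt0 := fun f : void => match f with end |}.

Definition pt : structure s0 := {| carrier := unit;
  fint := fun f : fun_sym s0 => match f : void with end;
  rint := fun f : rel_sym s0 => match f : void with end;
  cint := fun f : cst_sym s0 => match f : void with end |}.

Definition I (n : nat) : set (bool * bool) := [set u | u.1 = (n == 0)].
Definition J (n : nat) : set bool := setT.

Lemma I_gt1 n : exists i j, [/\ I n i, I n j & i <> j].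
Proof. by exists (n == 0, true), (n == 0, false). Qed.

Lemma J_gt1 n : exists i j, [/\ J n i, J n j & i <> j].
Proof. by exists true, false. Qed.

Lemma IJ n : I n #<= J n.
Proof.
apply/card_leP/injfunPex.
exists (fun u : I n => exist _ (sval u).2 (mem_set Logic.I) : J n) => //.
move=> [[a b] /= p] [[a' b'] /= p'] _ _ [/= e]; apply: eq_exist => /=.
by move: p p'; rewrite !inE /I /= => -> ->; rewrite e.
Qed.

Lemma stage_succP {T} (K : nat -> set T) n x : stage K (A:=pt) n.+1 x ->
  stage K n x \/ exists2 f, x = Fn (K n) f & forall j, stage K n (f j).
Proof.
move e: n.+1 => m mx; case: m x / mx e => [m a z|p m f pm fs|p m x pm|p m x [_]].
- by move=> e; move: (z 0); rewrite -e leEnat.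
- move=> e; rewrite -e in pm; right.
  by move: f fs; rewrite (is_succ_inj pm (succ_nat n)) => f fs; exists f.
- by move=> px e; rewrite -e in pm; left; rewrite -(is_succ_inj pm (succ_nat n)).
- by move=> nl _ _ e; case: nl; exists n; rewrite -e; exact: succ_nat.
Qed.

Lemma stage0 {T} (K : nat -> set T) x : stage K (A:=pt) 0%N x -> x = Atom tt.
Proof. by move=> /(zero_Atom nat_wo)[]// [->]. Qed.

Definition isA {T} (x : obj T pt) := if x is Atom _ then true else false.

Definition dec T (D : set T) (b : bool) : obj T pt := if b then Atom tt else Fn D (fun=> Atom tt).

Lemma stage1 x : stage J (A:=pt) 1%N x -> x = dec setT (isA x).
Proof.
move/stage_succP => [/stage0 ->//|[f -> fs]]; rewrite /dec /=.
by congr Fn; apply/funext => j; rewrite (stage0 (fs j)).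
Qed.

Definition code (y : obj bool pt) : option (bool * bool) :=
  if isA y then None else Some (isA (obj_app y true), isA (obj_app y false)).

Definition decode (c : option (bool * bool)) : obj bool pt :=
  if c is Some (u, v) then Fn setT (fun j => dec setT (if sval j then u else v)) else Atom tt.

Lemma codeK x : stage J (A:=pt) 2%N x -> x = decode (code x).
Proof.
suff H f : (forall j, stage J (A:=pt) 1 (f j)) -> Fn (J 1) f = decode (code (Fn (J 1) f)).
  move/stage_succP => [/stage_succP [/stage0 ->//|[f -> fs]]|[f -> fs]]; apply: H => // j.
  by rewrite (stage0 (fs j)); exact: (stage_Atom nat_wo).
move=> fs; rewrite /code /decode /=; congr Fn; apply/funext => -[j Jj] /=.
rewrite [LHS]stage1 //; congr dec.
by case: j Jj => Jj; case: pselect => // Jj'; congr (isA (f (exist _ _ _))); exact: Prop_irrelevance.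
Qed.

Definition elt (c : option (option (bool * bool))) : obj (bool * bool) pt :=
  match c with
  | None => Atom tt
  | Some None => dec (I 0) false
  | Some (Some (u, v)) => Fn (I 1) (fun j => dec (I 0) (if (sval j).2 then u else v))
  end.

Lemma elt_stage c : stage I (A:=pt) 2%N (elt c).
Proof.
have H0 : stage I (A:=pt) 0%N (Atom tt) by exact: (stage_Atom nat_wo).
have H1 b : stage I (A:=pt) 1%N (dec (I 0) b).
  by case: b; [exact: (stage_Atom nat_wo)|exact: stage_fun (succ_nat 0) _].
case: c => [[[u v]|]|] /=; last exact: (stage_Atom nat_wo).
  by apply: stage_fun (succ_nat 1) _ => j.
exact: stage_succ (succ_nat 1) (H1 false).
Qed.

Lemma I01 : I 0 <> I 1.
Proof. by move/(congr1 (fun D => D (true, true))); rewrite /I /= => e; have : true = false by rewrite -e. Qed.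

Lemma elt_inj : injective elt.
Proof.
have dI u v : isA (dec (I 0) u) = isA (dec (I 0) v) -> u = v by case: u; case: v.
case=> [[[u v]|]|] [[[u' v']|]|] //= e.
- have K b : I 1 (false, b) by [].
  have E b := congr1 (fun x => isA (obj_app x (false, b))) e.
  have := E true; rewrite !(obj_appE _ (K true)) /= => /dI ->.
  by have := E false; rewrite !(obj_appE _ (K false)) /= => /dI ->.
- by case: I01; move/(congr1 (@obj_dom _ _)): e.
- by case: I01; move/(congr1 (@obj_dom _ _)): e.
Qed.

Lemma no_embedding : ~ power_embeds (power nat_wo I pt 2) (power nat_wo J pt 2).
Proof.
move=> [h [h_inj _ _ _]].
pose g c := code (sval (h (exist _ _ (elt_stage c)))).
suff /leq_card : injective g by rewrite !card_option card_prod card_bool.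
move=> c c' /(congr1 decode); rewrite -!codeK; last 2 first.
- exact: svalP (h _).
- exact: svalP (h _).
move=> e; apply: elt_inj.
have : h (exist _ _ (elt_stage c)) = h (exist _ _ (elt_stage c')).
  by move: e; case: (h _) => x xs; case: (h _) => y ys /= e; apply: eq_exist.
by move/h_inj => [].
Qed.

End IndexCompatible.

(* Main.v *)
Require Import Defs.
From mathcomp Require Import all_boot all_order.
From mathcomp Require Import boolp classical_sets functions cardinality wochoice.
Local Open Scope order_scope.
Local Open Scope classical_set_scope.
Local Open Scope card_scope.

(** Inject [I p] into [J p] and invert to get surjections [J p -> I p]. An
    element [x] of level [p + 1] is a function on [I p]; composing it with the
    surjection, and transporting its values recursively, gives a function on
    [J p]. By compatibility of the index families this preserves levels, so it
    commutes with [theta], and everything else follows by induction. *)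

Set Implicit Arguments.
Unset Strict Implicit.
Unset Printing Implicit Defensive.
Import Order.TTheory.

(** Invert the injection on its image and send all other points to a fixed element of [A], which is
    why [A] is taken nonempty. *)
Lemma card_le_surj (U V : Type) (A : set U) (B : set V) :
  A !=set0 -> A #<= B ->
  exists g : V -> U, (forall v, B v -> A (g v)) /\
    forall u, A u -> exists2 v, B v & g v = u.
Proof.
move=> [u0 Au0] /card_leP/injfunPex[f _ f_inj].
have /choice[g gP] v : exists u,
    A u /\ forall w : A, set_val (f w) = v -> set_val w = u.
  have [[w wv]|nw] := pselect (exists w : A, set_val (f w) = v); last first.
    by exists u0; split=> // w wv; case: nw; exists w.
  exists (set_val w); split; first exact: set_valP.
  move=> w' w'v; congr set_val; apply: f_inj; rewrite ?in_setT //.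
  by apply: val_inj; rewrite [LHS]w'v.
exists g; split=> [v _|u Au]; first by case: (gP v).
exists (set_val (f (SigSub (mem_set Au)))); first exact: set_valP.
by have [_ /(_ _ erefl) <-] := gP (set_val (f (SigSub (mem_set Au)))).
Qed.

(** * Constants and relations on the stages *)

Section Levels.
Context {d : Order.disp_t} {On : orderType d}.
Context (On_wo : well_order (<=%O : rel On)).
Context {U : Type} (I : On -> set U) {s : signature} (A : structure s).
Local Notation O := (obj U A).

(** All urelements from which [x] is built are the constant. No stage is mentioned, so that
    membership in a stage and constancy can be transported separately. *)
Fixpoint hereditary_cst (c : cst_sym s) (x : O) : Prop :=
  match x with
  | Atom a => a = cint A c
  | Fn D f => forall j, hereditary_cst c (f j)
  end.

Lemma cst_stageP c b (x : O) :
  cst_stage I c b x <-> stage I b x /\ hereditary_cst c x.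
Proof.
split=> [|[]].
  elim=> {b x} [b zb|p b f pb _ IH|p b x pb _ [px xc]|p b x lb pb _ [px xc]].
  - by split=> //; exact: stage_zero.
  - split=> [|j]; last by case: (IH j).
    by apply: stage_fun pb _ => j; case: (IH j).
  - by split=> //; exact: stage_succ px.
  - by split=> //; exact: stage_limit px.
elim=> {b x} [b a zb /= ->|p b f pb _ IH /= fc|p b x pb _ IH xc|p b x lb pb _ IH xc].
- exact: cst_stage_zero.
- by apply: cst_stage_fun pb _ => j; exact: IH.
- by apply: cst_stage_succ pb _; exact: IH.
- by apply: cst_stage_limit pb _ => //; exact: IH.
Qed.

(** Only the base rule can apply: atoms have level zero, which is not a successor. *)
Lemma rel_stage_AtomP r b (a : 'I_(rel_arity r) -> A) :
  rel_stage I b (fun i => Atom (a i)) <-> rint a.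
Proof.
split=> [|ra]; last exact: rel_stage0.
move ea: (fun i => Atom (a i)) => a' ra'.
case: ra' ea => [{}b {}a' ra' ea|{}b p q {}a' _ aq pq _ ea].
  suff -> : a = a' by [].
  by apply/funext => i; move/(congr1 (fun g => g i)): ea => -[].
by case: (succ_nonzero pq); move: aq; rewrite -ea; exact: max_level_Atom.
Qed.

(** The inductive rule can be inverted because the maximal level [q] and its predecessor [p] are
    unique. *)
Lemma rel_stage_succP r b p q (a : 'I_(rel_arity r) -> O) :
  max_level I a q -> is_succ p q -> q <= b ->
  rel_stage I b a <-> forall j, I p j -> rel_stage I p (fun i => theta I q j (a i)).
Proof.
move=> aq pq qb; split=> [ra|]; last first.
  exact: rel_stageS (max_level_stage On_wo aq qb) aq pq.
case: ra aq => {b a qb} [b a _ /(max_level_Atom On_wo)/(succ_nonzero pq)//|].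
move=> b p' q' a _ aq' p'q' ra aq.
move: p'q' ra; rewrite -(max_level_inj aq aq') => p'q'.
by rewrite -(is_succ_inj pq p'q').
Qed.

End Levels.

(** * The transport map along surjections of index sets *)

Section Transport.
Context {d : Order.disp_t} {On : orderType d}.
Context (On_wo : well_order (<=%O : rel On)).
Context {U V : Type} (I : On -> set U) (J : On -> set V).
Context {s : signature} {A B : structure s}.
Context (e : A -> B) (sg : On -> V -> U) (b0 : On).

(* The default value [b0] is only taken on objects without a successor level. *)
Definition level_pred (x : obj U A) : On :=
  if pselect (exists p, exists2 q, is_succ p q & has_level I x q) is left ex
  then sval (cid ex) else b0.

(* The empty function is a junk value: if [Fn D f] has level [p + 1], then
   [D = I p], and [sg p] will be assumed to map [J p] into [I p]. *)
Fixpoint transport (x : obj U A) : obj V B :=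
  match x with
  | Atom a => Atom (e a)
  | Fn D f =>
    let p := level_pred (Fn D f) in
    Fn (J p) (fun j =>
      if pselect (D (sg p (sval j))) is left Dj then transport (f (exist _ _ Dj))
      else Fn set0 (fun u => False_rect _ (svalP u)))
  end.

Lemma level_predE x p q : has_level I x q -> is_succ p q -> level_pred x = p.
Proof.
move=> xq pq; rewrite /level_pred; case: pselect => [ex|[]]; last by exists p, q.
case: cid => p' /= [q' p'q' xq'].
by rewrite -(has_level_inj xq xq') in p'q'; exact: is_succ_inj p'q' pq.
Qed.

Context (sgI : forall p v, J p v -> I p (sg p v)).

(** By [sgI] the junk branch is never taken; [obj_app] hides the membership proof on which the value
    of [x] depends. *)
Lemma transportE x p q : has_level I x q -> is_succ p q ->
  transport x = Fn (J p) (fun j => transport (obj_app x (sg p (sval j)))).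
Proof.
move=> xq pq; have [f xE _] := level_succ xq pq; move: xq; rewrite xE => xq.
rewrite /= (level_predE xq pq); congr Fn; apply/funext => -[j pj] /=.
by case: pselect => // nI; case: nI; exact: sgI.
Qed.

Lemma obj_app_transport x p q j : has_level I x q -> is_succ p q -> J p j ->
  obj_app (transport x) j = transport (obj_app x (sg p j)).
Proof. by move=> xq pq pj; rewrite (transportE xq pq) (obj_appE _ pj). Qed.

(** * Preservation of levels *)

Context (sg_surj : forall p u, I p u -> exists2 v, J p v & sg p v = u).
Context (IJ_compat : index_compatible I J).

Lemma transport_level x q : has_level I x q -> has_level J (transport x) q.
Proof.
elim/(wo_ind On_wo): q x => q IH x xq.
have [[z [a xE]]|[p [pq [f xE fs]]]] := has_levelP xq.
  by rewrite xE; split=> [|r _]; [exact: stage_zero|exact: z].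
have [ltpq _] := pq.
have lev u : exists2 r, has_level I (f u) r & has_level J (transport (f u)) r /\ r <= p.
  have [r fr rp] := has_level_ex On_wo (fs u); exists r => //.
  by split=> //; apply: IH fr; exact: le_lt_trans ltpq.
split.
  rewrite (transportE xq pq); apply: stage_fun => // -[j pj] /=.
  rewrite xE (obj_appE _ (sgI pj)).
  by have [r _ [[] + _ rp]] := lev (exist _ _ (sgI pj)); exact: stage_mono.
(* No earlier stage contains the image: if its level is [r], then [x] itself is shown to lie in
   stage [r], hence [q <= r]. *)
move=> q' /(has_level_ex On_wo)[r xr rq']; apply: le_trans rq'.
have [[_ [b]]|[p' [p'r [f' hE f's]]]] := has_levelP xr.
  by rewrite (transportE xq pq).
have JE : J p' = J p.
  by move/(congr1 (@obj_dom _ _)): hE; rewrite (transportE xq pq).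
(* Equal domains do not give [p' = p], only equal index sets on the side of [J]; compatibility
   carries this over to [I]. *)
have IE : I p' = I p := IJ_compat JE.
have [_ xmin] := xq; apply: xmin; rewrite xE.
(* By surjectivity the image of each [f u] is among the values of [f'], which lie in stage [p']; by
   induction [f u] has the same level as its image. *)
have : forall u, stage I p' (f u).
  move=> [u pu]; have [v pv su] := sg_surj pu.
  have p'v : J p' v by rewrite JE.
  have [t [ft _] [[_ tmin] _]] := lev (exist _ u pu).
  apply: stage_mono ft => //; apply: tmin.
  have -> : transport (f (exist _ u pu)) = f' (exist _ v p'v).
    rewrite -(obj_appE _ p'v) -hE (obj_app_transport xq pq pv) xE su.
    by rewrite (obj_appE _ pu).
  exact: f's.
move: f {xE fs lev}; rewrite -IE => f fs.
exact: stage_fun.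
Qed.

Lemma transport_stage b c x : b <= c -> stage I b x -> stage J c (transport x).
Proof.
move=> bc /(has_level_ex On_wo)[q /transport_level[qx _] qb].
exact: stage_mono (le_trans qb bc) qx.
Qed.

Lemma transport_max_level n (a : 'I_n -> obj U A) q :
  max_level I a q -> max_level J (transport \o a) q.
Proof.
move=> [[i ai] am]; split; first by exists i; exact: transport_level.
by move=> k; have [r ar rq] := am k; exists r => //; exact: transport_level.
Qed.

(** Levels being preserved, either both maps evaluate ([r = q]) or both fix their argument
    ([r < q]). *)
Lemma theta_transport x r p q j : has_level I x r -> r <= q -> is_succ p q ->
  J p j -> theta J q j (transport x) = transport (theta I q (sg p j) x).
Proof.
move=> xr; rewrite le_eqVlt => /orP[/eqP rq|rq] pq pj.
  rewrite rq in xr; rewrite (thetaE xr pq (sgI pj)).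
  by rewrite (thetaE (transport_level xr) pq pj) (obj_app_transport xr pq pj).
by rewrite (theta_lt _ xr rq) (theta_lt _ (transport_level xr) rq).
Qed.

Lemma theta_max_transport n (a : 'I_n -> obj U A) p q j : max_level I a q ->
  is_succ p q -> J p j ->
  (fun i => theta J q j ((transport \o a) i)) =
  transport \o (fun i => theta I q (sg p j) (a i)).
Proof.
move=> [_ am] pq pj; apply/funext => i; have [r ar rq] := am i.
exact: theta_transport ar rq pq pj.
Qed.

(** Equal images force equal levels, and their values on [J p] determine those of [x] and [y] on
    [I p], since [sg p] is onto. *)
Lemma transport_inj b x y : injective e -> stage I b x -> stage I b y ->
  transport x = transport y -> x = y.
Proof.
move=> e_inj; elim/(wo_ind On_wo): b x y => b IH x y bx by_ xy.
have [q xq qb] := has_level_ex On_wo bx.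
have [q' yq' _] := has_level_ex On_wo by_.
have yq : has_level I y q.
  have := transport_level xq; rewrite xy => yq.
  by rewrite (has_level_inj yq (transport_level yq')).
have [[z _]|[p [pq _]]] := has_levelP xq.
  have [[xs _] [ys _]] := (xq, yq).
  have [a xE] := zero_Atom On_wo z xs; have [a' yE] := zero_Atom On_wo z ys.
  by move: xy; rewrite xE yE => -[/e_inj->].
have [f xE fs] := level_succ xq pq; have [g yE gs] := level_succ yq pq.
rewrite xE yE; congr Fn; apply/funext => -[u pu].
have [v pv vu] := sg_surj pu.
apply: (IH p) => //; first by case: pq => pq _; exact: lt_le_trans qb.
have := congr1 (fun z => obj_app z v) xy.
rewrite (obj_app_transport xq pq pv) (obj_app_transport yq pq pv) vu xE yE.
by rewrite !(obj_appE _ pu).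
Qed.

(** Induction on the derivation of [op_stage], with [c] arbitrary since the componentwise premises
    live at stage [p] on both sides. *)
Lemma transport_op f b c (a : 'I_(fun_arity f) -> obj U A) y :
  (forall a, e (fint (f := f) a) = fint (e \o a)) ->
  b <= c -> op_stage I b a y -> op_stage J c (transport \o a) (transport y).
Proof.
move=> ef + ay; elim: ay c => {b a y} [b a c _|b p q a y sa aq pq yq _ IH c bc].
  by rewrite /= ef; exact: op_stage0.
apply: (op_stageS _ (transport_max_level aq) pq (transport_level yq)).
  by move=> i; exact: transport_stage (sa i).
move=> j pj; rewrite (theta_max_transport aq pq pj) (obj_app_transport yq pq pj).
exact: IH (sgI pj) _ _.
Qed.

(** The clauses over [I p] and over [J p] agree: [sgI] gives preservation, surjectivity of [sg p]
    gives reflection. *)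
Lemma transport_rel r b c (a : 'I_(rel_arity r) -> obj U A) :
  (forall a, rint (r := r) a <-> rint (e \o a)) ->
  (forall i, stage I b (a i)) -> b <= c ->
  rel_stage I b a <-> rel_stage J c (transport \o a).
Proof.
move=> er; elim/(wo_ind On_wo): b a c => b IH a c sa bc.
have [q aq qb] := max_level_ex On_wo (rel_arity_gt0 r) sa.
have [[i0 ai0] am] := aq.
have [[z _]|[p [pq _]]] := has_levelP ai0.
  have /choice[a' aE] i : exists c, a i = Atom c.
    by apply: (zero_Atom On_wo z); exact: (max_level_stage On_wo aq).
  rewrite (funext aE).
  apply: iff_trans (rel_stage_AtomP On_wo I b a') _.
  apply: iff_trans (er a') _; apply: iff_sym.
  exact: (rel_stage_AtomP On_wo J c (e \o a')).
have pb : p < b by case: pq => pq _; exact: lt_le_trans pq qb.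
have IHp u : I p u -> rel_stage I p (fun i => theta I q u (a i)) <->
    rel_stage J p (transport \o (fun i => theta I q u (a i))).
  by move=> pu; apply: IH => // i; exact: theta_stage aq pq pu.
apply: iff_trans (rel_stage_succP On_wo aq pq qb) _; apply: iff_sym.
apply: iff_trans (rel_stage_succP On_wo (transport_max_level aq) pq (le_trans qb bc)) _.
split=> [ra u pu|ra j pj].
  have [v pv vu] := sg_surj pu; apply/IHp => //.
  by rewrite -vu -(theta_max_transport aq pq pv); exact: ra.
by rewrite (theta_max_transport aq pq pj); apply/IHp; [exact: sgI|exact/ra/sgI].
Qed.

(** The urelements in the image are exactly the images under [e] of those in [x]: by surjectivity no
    value of [x] is lost. *)
Lemma transport_cst k b x : injective e -> e (cint A k) = cint B k ->
  stage I b x -> hereditary_cst k x <-> hereditary_cst k (transport x).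
Proof.
move=> e_inj ek; elim/(wo_ind On_wo): b x => b IH x bx.
have [q xq qb] := has_level_ex On_wo bx.
have [[_ [a ->]] /=|[p [pq [f xE fs]]]] := has_levelP xq.
  by rewrite -ek; split=> [->//|/e_inj].
have pb : p < b by case: pq => pq _; exact: lt_le_trans pq qb.
rewrite (transportE xq pq) xE; split=> [fk [j pj]|fk [u pu]].
  change (hereditary_cst k (transport (obj_app (Fn (I p) f) (sg p j)))).
  by rewrite (obj_appE _ (sgI pj)); apply/(IH _ pb) => //; exact: fk.
have [v pv vu] := sg_surj pu; apply/(IH _ pb) => //.
have : hereditary_cst k (transport (obj_app (Fn (I p) f) (sg p v))) :=
  fk (exist _ v pv).
by rewrite vu (obj_appE _ pu).
Qed.

End Transport.

(** * Assembly of the embedding *)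

Theorem theorem2p28 (d : Order.disp_t) (On : orderType d)
    (On_wo : well_order (<=%O : rel On))
    (s : signature) (A B : structure s)
    (U V : Type) (I : On -> set U) (J : On -> set V)
    (I_gt1 : forall a, exists i j, [/\ I a i, I a j & i <> j])
    (J_gt1 : forall a, exists i j, [/\ J a i, J a j & i <> j])
    (IJ_compat : index_compatible I J)
    (AB : embeds A B)
    (IJ : forall a, I a #<= J a) :
  forall b c : On, b <= c ->
    power_embeds (power On_wo I A b) (power On_wo J B c).
Proof.
move=> b c bc; have [e [e_inj ef er ec]] := AB.
have /choice[sg sgP] p : exists g : V -> U, (forall v, J p v -> I p (g v)) /\
    forall u, I p u -> exists2 v, J p v & g v = u.
  by apply: card_le_surj; [have [i [j [Ii _ _]]] := I_gt1 p; exists i|exact: IJ].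
have sgI p := (sgP p).1; have sg_surj p := (sgP p).2.
(* Here [b] is only the default of [level_pred], not reached on elements of a stage, where every
   function has successor level. *)
pose t := transport I J e sg b.
have ts x : stage I b x -> stage J c (t x).
  exact: (transport_stage On_wo e b sgI sg_surj IJ_compat bc).
exists (fun x => exist _ (t (sval x)) (ts _ (svalP x))); split.
- move=> [x bx] [y by_] /(congr1 sval) /= xy; apply: eq_exist.
  exact: (transport_inj On_wo sgI sg_surj IJ_compat e_inj bx by_ xy).
- move=> f a; apply: eq_exist => /=.
  (* The operation of [power] picks its value by choice, so the two sides are compared through the
     functional relation [op_stage]. *)
  apply: (op_stage_inj On_wo _ (svalP (cid _))).
  exact: (transport_op On_wo b sgI sg_surj IJ_compat (ef f) bc (svalP (cid _))).
- move=> r a.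
  exact: (transport_rel On_wo b sgI sg_surj IJ_compat (er r) (fun i => svalP (a i)) bc).
- move=> k [x bx]; rewrite /= !cst_stageP.
  have kP := transport_cst On_wo b sgI sg_surj e_inj (ec k) bx.
  by split=> -[_ /kP xk]; split=> //; exact: ts.
Qed.
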